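(* Let $n,m\in\mathbb N_0$, let $q\in\mathbb C$ with $q\ne 0$, $|q|\ne1$, and let $\alpha,\beta\in\mathbb C$, such that no denominator below vanishes. Then the continuous $q$-Jacobi polynomials $P_n^{(\alpha,\beta)}(x|q)$ have the following special values in terms of $q$-Racah polynomials: (1) $P_n^{(\alpha,\beta)}\left(\tfrac12(q^{\frac\alpha2+\frac14+m}+q^{-\frac\alpha2-\frac14-m})|q\right)$ equals $$\frac{(q^{\alpha+1};q)_n}{(q;q)_n}R_n\left(q^{\alpha+\frac12+m}+q^{-m};q^\alpha,q^\beta,-q^{\frac{\alpha+\beta}{2}},-q^{\frac{\alpha-\beta-1}{2}}|q\right) =\frac{(q^{\alpha+1};q)_n}{(q;q)_n}R_m\left(q^{\alpha+\beta+1+n}+q^{-n};-q^{\frac{\alpha+\beta}{2}},-q^{\frac{\alpha-\beta-1}{2}},q^{\alpha},q^\beta|q\right).$$ (2) $P_n^{(\alpha,\beta)}\left(\tfrac12(q^{\frac\alpha2+\frac34+m}+q^{-\frac\alpha2-\frac34-m})|q\right)$ equals $$q^{-\frac n2}\frac{(q^{\alpha+1},-q^{\frac{\alpha+\beta+3}{2}};q)_n}{(q,-q^{\frac{\alpha+\beta+1}{2}};q)_n}R_n\left(q^{\alpha+\frac32+m}+q^{-m};q^\alpha,q^\beta,-q^{\frac{\alpha+\beta+1}{2}},-q^{\frac{\alpha-\beta}{2}}|q\right)$$ $$=q^{-\frac n2}\frac{(q^{\alpha+1},-q^{\frac{\alpha+\beta+3}{2}};q)_n}{(q,-q^{\frac{\alpha+\beta+1}{2}};q)_n}R_m\left(q^{\alpha+\beta+1+n}+q^{-n};-q^{\frac{\alpha+\beta+1}{2}},-q^{\frac{\alpha-\beta}{2}},q^{\alpha},q^\beta|q\right).$$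 (3) $P_n^{(\alpha,\beta)}\left(-\tfrac12(q^{\frac\beta2+\frac14+m}+q^{-\frac\beta2-\frac14-m})|q\right)$ equals $$\left(-q^{\frac{\alpha-\beta}{2}}\right)^n\frac{(q^{\beta+1};q)_n}{(q;q)_n}R_n\left(q^{\beta+\frac12+m}+q^{-m};q^\beta,q^\alpha,-q^{\frac{\alpha+\beta}{2}},-q^{\frac{\beta-\alpha-1}{2}}|q\right)$$ $$=\left(-q^{\frac{\alpha-\beta}{2}}\right)^n\frac{(q^{\beta+1};q)_n}{(q;q)_n}R_m\left(q^{\alpha+\beta+1+n}+q^{-n};-q^{\frac{\alpha+\beta}{2}},-q^{\frac{\beta-\alpha-1}{2}},q^{\beta},q^\alpha|q\right).$$ (4) $P_n^{(\alpha,\beta)}\left(-\tfrac12(q^{\frac\beta2+\frac34+m}+q^{-\frac\beta2-\frac34-m})|q\right)$ equals $$\left(-q^{\frac{\alpha-\beta-1}{2}}\right)^n\frac{(q^{\beta+1},-q^{\frac{\alpha+\beta+3}{2}};q)_n}{(q,-q^{\frac{\alpha+\beta+1}{2}};q)_n}R_n\left(q^{\beta+\frac32+m}+q^{-m};q^\beta,q^\alpha,-q^{\frac{\alpha+\beta+1}{2}},-q^{\frac{\beta-\alpha}{2}}|q\right)$$ $$=\left(-q^{\frac{\alpha-\beta-1}{2}}\right)^n\frac{(q^{\beta+1},-q^{\frac{\alpha+\beta+3}{2}};q)_n}{(q,-q^{\frac{\alpha+\beta+1}{2}};q)_n}R_m\left(q^{\alpha+\beta+1+n}+q^{-n};-q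^{\frac{\alpha+\beta+1}{2}},-q^{\frac{\beta-\alpha}{2}},q^\beta,q^{\alpha}|q\right).$$
   Context: Complex powers of $q$: fix a logarithm $\log q$ and set $q^s:=\exp(s\log q)$. Notation: $(a;q)_n:=\prod_{k=0}^{n-1}(1-aq^k)$, and $(a_1,\dots,a_r;q)_n:=\prod_i (a_i;q)_n$. Askey--Wilson polynomials: for $x=\frac12(z+z^{-1})$, $z\in\mathbb C\setminus\{0\}$, $$p_n(x;a,b,c,d|q):=a^{-n}(ab,ac,ad;q)_n\sum_{k=0}^n\frac{(q^{-n},q^{n-1}abcd,az,az^{-1};q)_k}{(q,ab,ac,ad;q)_k}q^k,$$ where $(ab;q)_n/(ab;q)_k$ is read as $(abq^k;q)_{n-k}$ (likewise for $ac$, $ad$), so that $p_n$ is always defined. Continuous $q$-Jacobi polynomials: $$P_n^{(\alpha,\beta)}(x|q):=\frac{q^{(\frac{\alpha}{2}+\frac14)n}}{(q,-q^{\frac{\alpha+\beta+1}{2}},-q^{\frac{\alpha+\beta+2}{2}};q)_n}\,p_n\left(x;q^{\frac{\alpha}{2}+\frac14},q^{\frac{\alpha}{2}+\frac34},-q^{\frac{\beta}{2}+\frac14},-q^{\frac{\beta}{2}+\frac34}\big|q\right).$$ $q$-Racah polynomials: with $\mu(m)=q^{-m}+q^{m+1}\bar\gamma\bar\delta$, $m,n\in\mathbb N_0$, $$R_n(\mu(m);\bar\alpha,\bar\beta,\bar\gamma,\bar\delta|q):=\sum_{k=0}^{\min(m,n)}\frac{(q^{-n},q^{n+1}\bar\alpha\bar\beta,q^{-m},q^{m+1}\bar\gamma\bar\delta;q)_k}{(q,q\bar\alpha,q\bar\beta\bar\delta,q\bar\gamma;q)_k}q^k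 .$$ No truncation condition (such as $\bar\alpha=q^{-N-1}$) is imposed here; the sum terminates because $m,n\in\mathbb N_0$. *)

(* Defs.v *)
From mathcomp Require Import all_boot all_order all_algebra.
From mathcomp Require Import complex.
From mathcomp Require Import reals sequences trigo.
From mathcomp Require Import ring.

Set Implicit Arguments.
Unset Strict Implicit.
Unset Printing Implicit Defensive.

Import Order.TTheory GRing.Theory Num.Theory.

Local Open Scope ring_scope.
Local Open Scope complex_scope.

Definition cexp (R : realType) (z : R[i]) : R[i] :=
  let: x +i* y := z in (expR x * cos y) +i* (expR x * sin y).

(* The power q^s for the branch L of log q, i.e. for L with cexp L = q. *)
Definition qpow (R : realType) (L s : R[i]) : R[i] := cexp (s * L).

Definition qpoch (F : fieldType) (q a : F) (n : nat) : F :=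
  \prod_(k < n) (1 - a * q ^+ k).

Definition qpochs (F : fieldType) (q : F) (s : seq F) (n : nat) : F :=
  \prod_(a <- s) qpoch q a n.

(* The Askey-Wilson polynomial at x = (z + 1/z) / 2, as a function of z. The
   quotients (ab;q)_n / (ab;q)_k, etc., are written (ab q^k;q)_(n-k), so no
   condition on ab, ac, ad is needed. *)
Definition askey_wilson_z (F : fieldType) (q : F) (n : nat) (a b c d z : F) :
    F :=
  a ^- n * \sum_(k < n.+1)
    qpochs q [:: q ^- n; q ^ (n%:Z - 1) * (a * b * c * d); a * z; a * z^-1] k
    / qpoch q q k
    * qpochs q [:: a * b * q ^+ k; a * c * q ^+ k; a * d * q ^+ k] (n - k)
    * q ^+ k.

(* One solution z != 0 of x = (z + 1/z) / 2 is picked; the other one is 1/z and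
   gives the same value, see askey_wilsonE. *)
Definition askey_wilson (R : realType) (q : R[i]) (n : nat)
    (a b c d x : R[i]) : R[i] :=
  askey_wilson_z q n a b c d (x + sqrtc (x ^+ 2 - 1)).

Lemma askey_wilson_zV (F : fieldType) (q : F) (n : nat) (a b c d z : F) :
  askey_wilson_z q n a b c d z^-1 = askey_wilson_z q n a b c d z.
Proof.
rewrite /askey_wilson_z; congr (_ * _); apply: eq_bigr => k _.
congr (_ / _ * _ * _).
by rewrite /qpochs !big_cons !big_nil invrK !mulr1 [qpoch _ (a / z) _ * _]mulrC.
Qed.

Lemma askey_wilsonE (R : realType) (q : R[i]) (n : nat) (a b c d z : R[i]) :
  z != 0 ->
  askey_wilson q n a b c d ((z + z^-1) / 2) = askey_wilson_z q n a b c d z.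
Proof.
move=> z0; rewrite /askey_wilson.
set x := (z + z^-1) / 2; set s := sqrtc _.
have n2 : (2 : R[i]) != 0 by rewrite pnatr_eq0.
have : s ^+ 2 = ((z - z^-1) / 2) ^+ 2.
  rewrite /s sqr_sqrtc /x; field; by rewrite z0.
move/eqP; rewrite eqf_sqr => /orP[] /eqP ->.
  congr askey_wilson_z; rewrite /x; field; by rewrite z0.
rewrite -[RHS]askey_wilson_zV.
congr askey_wilson_z; rewrite /x; field; by rewrite z0.
Qed.

Definition qJacobi_den (R : realType) (q L : R[i]) (n : nat)
    (alpha beta : R[i]) : R[i] :=
  qpochs q [:: q; - qpow L ((alpha + beta + 1) / 2);
                  - qpow L ((alpha + beta + 2) / 2)] n.

Definition qJacobi (R : realType) (q L : R[i]) (n : nat)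
    (alpha beta x : R[i]) : R[i] :=
  qpow L ((alpha / 2 + 1 / 4) * n%:R) / qJacobi_den q L n alpha beta
  * askey_wilson q n
      (qpow L (alpha / 2 + 1 / 4)) (qpow L (alpha / 2 + 3 / 4))
      (- qpow L (beta / 2 + 1 / 4)) (- qpow L (beta / 2 + 3 / 4)) x.

Definition qRacah_mu (F : fieldType) (q : F) (m : nat) (c d : F) : F :=
  q ^- m + q ^+ m.+1 * c * d.

Definition qRacah_den (F : fieldType) (q a b c d : F) (k : nat) : F :=
  qpochs q [:: q; q * a; q * b * d; q * c] k.

(* The value R_n(mu(m); a, b, c, d | q), where mu(m) = qRacah_mu q m c d. *)
Definition qRacah (F : fieldType) (q : F) (n m : nat) (a b c d : F) : F :=
  \sum_(k < (minn m n).+1)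
    qpochs q [:: q ^- n; q ^+ n.+1 * a * b; q ^- m; q ^+ m.+1 * c * d] k
    / qRacah_den q a b c d k * q ^+ k.

Definition qRacah_defined (F : fieldType) (q : F) (n m : nat) (a b c d : F) :
    Prop :=
  forall k : nat, (k <= minn m n)%N -> qRacah_den q a b c d k != 0.

(* Main.v *)
Require Import Defs.
From mathcomp Require Import all_boot all_order all_algebra.
From mathcomp Require Import complex.
From mathcomp Require Import reals sequences exp trigo.
From mathcomp Require Import ring zify.

Import Order.TTheory GRing.Theory Num.Theory.

Local Open Scope ring_scope.
Local Open Scope complex_scope.

(* At z = e q^m, with e one of the four parameters of the Askey-Wilson polynomial,
   the factor (e/z; q)_k = (q^(-m); q)_k cuts off the 4phi3 series based at e,
   which is then a q-Racah series. For e = a this is the definition; the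
   other three cases follow since the Askey-Wilson polynomial is symmetric in
   a, b, c, d, which reduces to the terminating q-Saalschuetz sum. Both are used
   without denominators in the parameters, so that degenerate values of
   (ab, ac, ad; q)_n need no separate treatment. The second form of each value
   is the duality R_n(mu(m); a, b, c, d) = R_m(mu(n); c, d, a, b), which is
   visible termwise. *)

(** * Elementary identities for q-shifted factorials *)

Section QPochhammer.

Variables (F : fieldType) (q : F).

Lemma qpoch0 (a : F) : qpoch q a 0 = 1.
Proof. by rewrite /qpoch big_ord0. Qed.

Lemma qpochS (a : F) (n : nat) :
  qpoch q a n.+1 = qpoch q a n * (1 - a * q ^+ n).
Proof. by rewrite /qpoch big_ord_recr. Qed.

Lemma qpochD (a : F) (m n : nat) :
  qpoch q a (m + n) = qpoch q a m * qpoch q (a * q ^+ m) n.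
Proof.
rewrite /qpoch big_split_ord; congr (_ * _).
by apply: eq_bigr => i _; rewrite /= exprD mulrA.
Qed.

Lemma qpochSl (a : F) (n : nat) :
  qpoch q a n.+1 = (1 - a) * qpoch q (a * q) n.
Proof. by rewrite -add1n qpochD qpochS qpoch0 mul1r expr0 mulr1 expr1. Qed.

Lemma qpoch_div (a : F) (k n : nat) : (k <= n)%N -> qpoch q a k != 0 ->
  qpoch q (a * q ^+ k) (n - k) = qpoch q a n / qpoch q a k.
Proof. by move=> kn a0; rewrite -{2}(subnKC kn) qpochD mulrAC divff ?mul1r. Qed.

Hypothesis q0 : q != 0.

Lemma qpochVX_eq0 (m k : nat) : (m < k)%N -> qpoch q (q ^- m) k = 0.
Proof.
move=> mk; apply/eqP/prodf_eq0; exists (Ordinal mk) => //=.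
by rewrite mulVf ?subrr // expf_neq0.
Qed.

(** Each factor [1 - x q^k] equals [- x q^k (1 - q^(-k) / x)]. Reading the new factors in the
    opposite order gives a product with base [q^(1-n) / x], and the extracted powers of [q] add up
    to ['C(n, 2)]. *)
Lemma qpoch_rev (x : F) (n : nat) : x != 0 ->
  qpoch q x n = (- x) ^+ n * q ^+ 'C(n, 2) * qpoch q (q / (x * q ^+ n)) n.
Proof.
move=> x0; elim: n => [|n IH]; first by rewrite !qpoch0 !expr0 !mul1r.
rewrite qpochS IH qpochSl binS bin1 !exprS exprD.
have -> : q / (x * (q * q ^+ n)) * q = q / (x * q ^+ n).
  by field; rewrite x0 q0 expf_neq0.
by field; rewrite x0 q0 expf_neq0.
Qed.

(** * The terminating q-Saalschuetz sum *)

Hypothesis qq0 : forall n, qpoch q q n != 0.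

Definition qbin (n k : nat) : F := qpoch q q n / (qpoch q q k * qpoch q q (n - k)).

(** This is the balanced 3phi2 with upper parameters [q^(-n), u, v] and lower parameters
    [uvw, q^(1-n)/w], multiplied by [(uvw, w; q)_n]. Every term is then polynomial in [u, v, w], so
    no genericity is required of them. *)
Lemma q_Saalschutz (u v w : F) (n : nat) :
  \sum_(k < n.+1) qbin n k * qpoch q u k * qpoch q v k * qpoch q w (n - k)
    * qpoch q (u * v * w * q ^+ k) (n - k) * w ^+ k
  = qpoch q (u * w) n * qpoch q (v * w) n.
Proof.
pose saal n k := qbin n k * qpoch q u k * qpoch q v k * qpoch q w (n - k)
  * qpoch q (u * v * w * q ^+ k) (n - k) * w ^+ k.
rewrite -[LHS]/(\sum_(k < n.+1) saal n k).
elim: n => [|n IH].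
  by rewrite big_ord1 /saal /qbin !qpoch0 !expr0; field; rewrite oner_eq0.
(* Creative telescoping: the last term is the certificate. *)
have partial j : (j <= n)%N -> \sum_(k < j.+1) saal n.+1 k =
    (1 - u * w * q ^+ n) * (1 - v * w * q ^+ n) * (\sum_(k < j.+1) saal n k)
    - q ^+ (n - j) * w * (1 - u * q ^+ j) * (1 - v * q ^+ j) * saal n j.
  elim: j => [_|j IHj jn].
    rewrite !big_ord1 /saal /qbin !subn0 !qpoch0 !expr0 !mulr1 !qpochS.
    have := qq0 n.+1; rewrite qpochS mulf_eq0 negb_or => /andP[h1 h2].
    by field; rewrite h1 h2.
  rewrite big_ord_recr [in RHS]big_ord_recr /= IHj 1?ltnW // /saal /qbin.
  have [r ->] : exists r, n = (j.+1 + r)%N by exists (n - j.+1)%N; rewrite subnKC.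
  have -> : ((j.+1 + r).+1 - j.+1 = r.+1)%N by lia.
  have -> : (j.+1 + r - j.+1 = r)%N by lia.
  have -> : (j.+1 + r - j = r.+1)%N by lia.
  have := qq0 (j.+1 + r).+1; rewrite qpochS mulf_eq0 negb_or => /andP[h1 h2].
  have := qq0 j.+1; rewrite qpochS mulf_eq0 negb_or => /andP[h3 h4].
  have := qq0 r.+1; rewrite qpochS mulf_eq0 negb_or => /andP[h5 h6].
  have -> : qpoch q (u * v * w * q ^+ j) r.+1
     = (1 - u * v * w * q ^+ j) * qpoch q (u * v * w * q ^+ j.+1) r.
    by rewrite qpochSl exprSr mulrA.
  rewrite !qpochS; move: h1 h2 h3 h4 h5 h6; rewrite !exprD !exprS.
  move=> h1 h2 h3 h4 h5 h6.
  by field; rewrite h3 h4 h5 h6.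
(* At [j = n] the certificate equals the top term [saal n.+1 n.+1]. They cancel, and what remains is
   the first-order recurrence satisfied by the right-hand side. *)
rewrite big_ord_recr /= partial // IH /saal /qbin !subnn !qpochS !qpoch0 !expr0.
have := qq0 n.+1; rewrite qpochS mulf_eq0 negb_or => /andP[h1 h2].
by rewrite !exprS; field; rewrite h1 h2.
Qed.

(* [q_Saalschutz] at [w = q^(1-n) / d]. *)
Lemma q_Saalschutz_rev (t c d : F) (n : nat) : t != 0 -> d != 0 ->
  \sum_(k < n.+1) qpoch q (q ^- n) k / qpoch q q k * q ^+ k
    * qpoch q (c * d * q ^+ n / (q * t)) k * qpoch q t k
    * qpoch q (c * q ^+ k) (n - k) * qpoch q (d * q ^+ k) (n - k)
  = t ^+ n * qpoch q (c / t) n * qpoch q (d / t) n.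
Proof.
move=> t0 d0.
have qX k : q ^+ k != 0 by rewrite expf_neq0.
have := q_Saalschutz t (c * d * q ^+ n / (q * t)) (q / (d * q ^+ n)) n.
have -> : t * (c * d * q ^+ n / (q * t)) * (q / (d * q ^+ n)) = c.
  by field; rewrite t0 d0 q0 qX.
have -> : c * d * q ^+ n / (q * t) * (q / (d * q ^+ n)) = c / t.
  by field; rewrite t0 d0 q0 qX.
(* This factor is [t^n] times the one that reversing [(d/t; q)_n] produces. *)
move=> /(congr1 (fun x => (- d) ^+ n * q ^+ 'C(n, 2) * x)).
have -> : (- d) ^+ n * q ^+ 'C(n, 2) *
  (qpoch q (t * (q / (d * q ^+ n))) n * qpoch q (c / t) n) =
  t ^+ n * qpoch q (c / t) n * qpoch q (d / t) n.
  rewrite (@qpoch_rev (d / t)) ?mulf_neq0 ?invr_neq0 //.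
  have -> : q / (d / t * q ^+ n) = t * (q / (d * q ^+ n)).
    by field; rewrite t0 d0 qX.
  rewrite -mulNr expr_div_n; field; by rewrite expf_neq0.
move=> <-; rewrite big_distrr; apply: eq_bigr => -[k /=]; rewrite ltnS => kn _.
(* Reversing [(q^(-n); q)_k] yields [(q; q)_n / (q; q)_(n-k)], the missing part of [qbin]; reversing
   [(d q^k; q)_(n-k)] yields [(w; q)_(n-k)]. The rest compares powers of [-1], [d] and [q]. *)
rewrite (@qpoch_rev (q ^- n)) ?invr_neq0 //.
rewrite (@qpoch_rev (d * q ^+ k)) ?mulf_neq0 // /qbin.
have [r ->] : exists r, n = (k + r)%N by exists (n - k)%N; rewrite subnKC.
rewrite addKn.
have -> : q / (d * q ^+ k * q ^+ r) = q / (d * q ^+ (k + r)) by rewrite exprD mulrA.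
have -> : q / (q ^- (k + r) * q ^+ k) = q * q ^+ r.
  by rewrite exprD; field; rewrite !qX oner_eq0.
have -> : qpoch q q (k + r) = qpoch q q r * qpoch q (q * q ^+ r) k by rewrite addnC qpochD.
have -> : 'C(k + r, 2) = ('C(k, 2) + 'C(r, 2) + k * r)%N.
  elim: (k) => [|i IH]; first by rewrite add0n mul0n addn0 bin0n.
  by rewrite addSn !binS !bin1 IH mulSn; lia.
have qk2 : q ^+ (k * k) = q ^+ 'C(k, 2) * q ^+ 'C(k, 2) * q ^+ k.
  by rewrite -!exprD; congr (_ ^+ _); elim: (k) => [|i IH] //;
     rewrite binS bin1 mulSn mulnS IH; lia.
have -> : (- q ^- (k + r)) ^+ k
    = (-1) ^+ k / (q ^+ 'C(k, 2) * q ^+ 'C(k, 2) * q ^+ k * q ^+ (k * r)).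
  by rewrite -qk2 -exprD -mulnDr mulnC exprM -(mulN1r (q ^- _)) exprMn exprVn.
have -> : (- (d * q ^+ k)) ^+ r = (-1) ^+ r * d ^+ r * q ^+ (k * r).
  by rewrite -(mulN1r (d * _)) !exprMn exprM mulrA.
have -> : (- d) ^+ (k + r) = (-1) ^+ k * (-1) ^+ r * d ^+ k * d ^+ r.
  by rewrite -(mulN1r d) exprMn !exprD mulrA.
rewrite exprMn exprVn exprMn -(exprM q (k + r)) mulnDl (mulnC r) !exprD qk2.
by field; rewrite !qX !qq0 ?expf_neq0.
Qed.

(** * Symmetry of the Askey-Wilson polynomials in their parameters *)

Lemma sum_triangle (f : nat -> nat -> F) (n : nat) :
  \sum_(k < n.+1) \sum_(j < k.+1) f k j
  = \sum_(j < n.+1) \sum_(i < (n - j).+1) f (j + i)%N j.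
Proof.
elim: n => [|n IH]; first by rewrite !big_ord1.
rewrite big_ord_recr /= IH [in RHS]big_ord_recr /= subnn big_ord1 addn0.
rewrite [X in _ + X = _]big_ord_recr /= addrA -big_split /=; congr (_ + _).
apply: eq_bigr => j _; have jn : (j <= n)%N by rewrite -ltnS.
by rewrite subSn // [RHS]big_ord_recr /= -subSn // subnKC // ltnW.
Qed.

(* This is Sears' transformation. The proof expands (az, a/z; q)_k in the basis
   (bz, b/z; q)_j by [q_Saalschutz]; after interchanging the sums, the
   coefficient of (bz, b/z; q)_j is evaluated by [q_Saalschutz_rev]. *)
Lemma askey_wilson_z_swap (n : nat) (a b c d z : F) :
    a != 0 -> b != 0 -> d != 0 -> z != 0 ->
  askey_wilson_z q n a b c d z = askey_wilson_z q n b a c d z.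
Proof.
move=> a0 b0 d0 z0; rewrite /askey_wilson_z.
have qX k : q ^+ k != 0 by rewrite expf_neq0.
set X := q ^ (n%:Z - 1) * (a * b * c * d).
have XE : X = q ^+ n / q * (a * b * c * d) by rewrite /X expfzDr // exprN1.
have -> : q ^ (n%:Z - 1) * (b * a * c * d) = X by rewrite [b * a]mulrC.
pose f k j := qpoch q (q ^- n) k * qpoch q X k / qpoch q q k * q ^+ k
  * qpoch q (a * c * q ^+ k) (n - k) * qpoch q (a * d * q ^+ k) (n - k)
  * qbin k j * qpoch q (a / b) (k - j) * qpoch q (a * b * q ^+ j) (n - j)
  * (a / b) ^+ j * qpoch q (b * z) j * qpoch q (b / z) j.
transitivity (a ^- n * \sum_(k < n.+1) \sum_(j < k.+1) f k j).
  congr (_ * _); apply: eq_bigr => -[k /=]; rewrite ltnS => kn _.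
  rewrite /qpochs !big_cons !big_nil !mulr1.
  (* The choice [w = a/b] makes [uw = az], [vw = a/z] and [uvw = ab]. *)
  have := q_Saalschutz (b * z) (b / z) (a / b) k.
  have -> : b * z * (b / z) * (a / b) = a * b by field; rewrite b0 z0.
  have -> : b * z * (a / b) = a * z by field.
  have -> : b / z * (a / b) = a / z by field; rewrite b0 z0.
  move=> S.
  transitivity (qpoch q (q ^- n) k * qpoch q X k / qpoch q q k * q ^+ k
    * qpoch q (a * c * q ^+ k) (n - k) * qpoch q (a * d * q ^+ k) (n - k)
    * qpoch q (a * b * q ^+ k) (n - k)
    * (qpoch q (a * z) k * qpoch q (a / z) k)); first by field.
  rewrite -S big_distrr; apply: eq_bigr => -[j /=]; rewrite ltnS => jk _.
  rewrite /f.
  (* The factor [(ab q^j; q)_(k-j)] of the expansion joins [(ab q^k; q)_(n-k)] to form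
     [(ab q^j; q)_(n-j)], which is free of [k] and leaves the inner sum. *)
  have -> : (n - j = (k - j) + (n - k))%N by lia.
  rewrite (qpochD (a * b * q ^+ j)) -(mulrA (a * b)) -exprD subnKC //.
  ring.
rewrite sum_triangle !big_distrr; apply: eq_bigr => -[j /=]; rewrite ltnS => jn _.
rewrite /qpochs !big_cons !big_nil !mulr1.
(* In [i = k - j] the inner sum has length [n - j] and parameters shifted by [q^j]. Its value
   carries [(a/b)^(n-j)], which with [(a/b)^j] turns [a^(-n)] into [b^(-n)]. *)
have := q_Saalschutz_rev (a / b) (a * c * q ^+ j) (a * d * q ^+ j) (n - j).
rewrite !mulf_neq0 ?invr_neq0 // => /(_ isT isT).
have -> : a * c * q ^+ j / (a / b) = b * c * q ^+ j by field; rewrite a0 b0.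
have -> : a * d * q ^+ j / (a / b) = b * d * q ^+ j by field; rewrite a0 b0.
have -> : a * c * q ^+ j * (a * d * q ^+ j) * q ^+ (n - j) / (q * (a / b)) = X * q ^+ j.
  by rewrite XE -{2}(subnKC jn) exprD; field; rewrite q0 a0 b0.
move=> S.
transitivity (a ^- n * (a / b) ^+ j * qpoch q (q ^- n) j * qpoch q X j / qpoch q q j
  * q ^+ j * qpoch q (a * b * q ^+ j) (n - j) * qpoch q (b * z) j * qpoch q (b / z) j
  * ((a / b) ^+ (n - j) * qpoch q (b * c * q ^+ j) (n - j) * qpoch q (b * d * q ^+ j) (n - j))).
  rewrite -S !big_distrr; apply: eq_bigr => -[i /=]; rewrite ltnS => ij _.
  rewrite /f /qbin !addKn !qpochD !exprD subnDA.
  have -> : q ^- n * q ^+ j = q ^- (n - j).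
    by rewrite -{1}(subnKC jn) exprD; field; rewrite !qX.
  rewrite !mulrA.
  have := qq0 (j + i); rewrite qpochD mulf_eq0 negb_or => /andP[h1 h2].
  by field; rewrite !qq0 h2 expf_neq0.
rewrite [b * a]mulrC -{1}(subnKC jn) !expr_div_n exprD -[in b ^- n](subnKC jn) exprD.
by field; rewrite !expf_neq0 ?qq0 ?a0 ?b0.
Qed.

(** Only the base [a] is distinguished in the series. This 3-cycle and the transposition
    [askey_wilson_z_swap] generate all permutations of four nonzero parameters. *)
Lemma askey_wilson_z_perm (n : nat) (a b c d z : F) :
  askey_wilson_z q n a b c d z = askey_wilson_z q n a c d b z.
Proof.
rewrite /askey_wilson_z; congr (_ * _); apply: eq_bigr => k _.
rewrite /qpochs !big_cons !big_nil !mulr1.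
have -> : a * c * d * b = a * b * c * d by ring.
ring.
Qed.

(** * q-Racah polynomials: duality and Askey-Wilson values *)

Lemma qRacah_dual (n m : nat) (A B C D : F) :
  qRacah q n m A B C D = qRacah q m n C D A B.
Proof.
rewrite /qRacah minnC; apply: eq_bigr => k _.
rewrite /qRacah_den /qpochs !big_cons !big_nil !mulr1.
rewrite -(mulrA q B) -(mulrA q D) (mulrC B D).
congr (_ / _ * _); ring.
Qed.

(** For nonzero [c] and [d] the dictionary reads [A = ab/q], [B = cd/q], [C = ad/q], [D = a/d]. It
    is stated through products, which are exactly the combinations occurring in the two series. *)
Lemma askey_wilson_qRacah (n m : nat) (a b c d A B C D : F) : a != 0 ->
    q * A = a * b -> q * B = c * d -> q * B * D = a * c -> q * C = a * d ->
    q * C * D = a * a -> qRacah_defined q n m A B C D ->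
  askey_wilson_z q n a b c d (a * q ^+ m)
  = a ^- n * qpochs q [:: a * b; a * c; a * d] n * qRacah q n m A B C D.
Proof.
move=> a0 qA qB qBD qC qCD Rdef.
rewrite /askey_wilson_z /qRacah -(mulrA (a ^- n)); congr (_ * _).
have qX k : q ^+ k != 0 by rewrite expf_neq0.
have h1 : a * (a * q ^+ m) = q ^+ m.+1 * C * D.
  by rewrite mulrA -qCD exprS; ring.
have h2 : a / (a * q ^+ m) = q ^- m by field; rewrite a0 qX.
have h3 : q ^ (n%:Z - 1) * (a * b * c * d) = q ^+ n.+1 * A * B.
  have -> : a * b * c * d = q * A * (q * B) by rewrite qA qB !mulrA.
  by rewrite expfzDr // exprN1 exprS -exprnP; field.
rewrite h1 h2 h3 big_distrr /=.
pose f k := qpochs q [:: a * b; a * c; a * d] n *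
    (qpochs q [:: q ^- n; q ^+ n.+1 * A * B; q ^- m; q ^+ m.+1 * C * D] k
     / qRacah_den q A B C D k * q ^+ k).
(* The Askey-Wilson sum runs up to [n]. Its terms with [k > m] vanish through [(q^(-m); q)_k], so
   nonzero denominators are required only for [k <= minn m n], as [Rdef] provides. *)
rewrite -[RHS]/(\sum_(k < (minn m n).+1) f k) (big_ord_widen n.+1 f) ?ltnS ?geq_minr //.
rewrite [RHS]big_mkcond; apply: eq_bigr => -[k /=]; rewrite ltnS => kn _.
case: ifPn; last first.
  rewrite ltnS leq_min kn andbT -ltnNge => mk.
  by rewrite /qpochs !big_cons (qpochVX_eq0 _ _ mk) !(mul0r, mulr0).
rewrite ltnS => kmn; have := Rdef _ kmn.
rewrite /f /qRacah_den /qpochs !big_cons !big_nil !mulr1 qA qBD qC.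
rewrite !mulf_eq0 !negb_or => /and4P[u1 u2 u3 u4].
rewrite !qpoch_div //.
by field; rewrite u1 u2 u3 u4.
Qed.

End QPochhammer.

(** * Complex powers of [q] for a fixed logarithm *)

Section ComplexPowers.

Variables (R : realType) (L : R[i]).

Lemma cexpD (z w : R[i]) : cexp (z + w) = cexp z * cexp w.
Proof.
case: z w => [a b] [c d]; rewrite /cexp /= expRD cosD sinD.
by apply/eqP; rewrite eq_complex /=; apply/andP; split; apply/eqP; ring.
Qed.

Lemma cexp0 : cexp (0 : R[i]) = 1.
Proof. by rewrite /cexp /= expR0 cos0 sin0 mulr0 mulr1. Qed.

Lemma qpow0 : qpow L 0 = 1.
Proof. by rewrite /qpow mul0r cexp0. Qed.

Lemma qpowD (s t : R[i]) : qpow L (s + t) = qpow L s * qpow L t.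
Proof. by rewrite /qpow mulrDl cexpD. Qed.

Lemma qpow_neq0 (s : R[i]) : qpow L s != 0.
Proof.
apply/eqP => h; have := qpowD s (- s).
by rewrite h mul0r subrr qpow0 => /eqP; rewrite oner_eq0.
Qed.

Lemma qpowN (s : R[i]) : qpow L (- s) = (qpow L s)^-1.
Proof. by apply: (mulfI (qpow_neq0 s)); rewrite -qpowD subrr qpow0 divff ?qpow_neq0. Qed.

Lemma qpowMn (s : R[i]) (n : nat) : qpow L (s * n%:R) = qpow L s ^+ n.
Proof.
elim: n => [|n IH]; first by rewrite mulr0 qpow0.
by rewrite -natr1 mulrDr mulr1 qpowD IH exprSr.
Qed.

Lemma qpow_nat (n : nat) : qpow L n%:R = cexp L ^+ n.
Proof. by rewrite -[n%:R]mul1r qpowMn /qpow mul1r. Qed.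

End ComplexPowers.

(** * Continuous q-Jacobi polynomials at the nodes *)

Lemma qpoch_self_neq0 (R : realType) (q : R[i]) (n : nat) :
  `|q| != 1 -> qpoch q q n != 0.
Proof.
move=> q1; apply/prodf_neq0 => k _; rewrite subr_eq0 eq_sym -exprS.
apply: contra q1 => /eqP/(congr1 Num.norm); rewrite normrX normr1 => /eqP.
by rewrite pexpr_eq1.
Qed.

(** Splitting an exponent into positive and negative parts turns each power into a quotient of
    monomials in three nonzero atoms, so identities between powers become rational identities for
    [field]. *)
Lemma qpow_quarters (R : realType) (L alpha beta s : R[i])
    (i j k i' j' k' : nat) :
    s = ((alpha *+ i + beta *+ j + k%:R) - (alpha *+ i' + beta *+ j' + k'%:R)) / 4 ->
  qpow L s = qpow L (alpha / 4) ^+ i * qpow L (beta / 4) ^+ j * qpow L (1 / 4) ^+ k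
    / (qpow L (alpha / 4) ^+ i' * qpow L (beta / 4) ^+ j' * qpow L (1 / 4) ^+ k').
Proof.
by move=> ->; rewrite -!qpowMn -!qpowD -qpowN -qpowD; congr qpow; field.
Qed.

(** The tuple [e1, e2, e3, e4] is a reordering of the four parameters with the base of the node
    first. The ratio [r] merges the power of [q] in the normalization with [e1^(-n)]; [r] and
    [p2, p3, p4] are free names so that the result appears with the desired exponents. *)
Lemma qJacobi_node (R : realType) (n m : nat)
    (q L alpha beta x e1 e2 e3 e4 r p2 p3 p4 A B C D : R[i]) :
    q != 0 -> e1 != 0 ->
    (forall z, z != 0 ->
      askey_wilson_z q n
        (qpow L (alpha / 2 + 1 / 4)) (qpow L (alpha / 2 + 3 / 4))
        (- qpow L (beta / 2 + 1 / 4)) (- qpow L (beta / 2 + 3 / 4)) z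
      = askey_wilson_z q n e1 e2 e3 e4 z) ->
    x = (e1 * q ^+ m + (e1 * q ^+ m)^-1) / 2 ->
    qRacah_defined q n m A B C D ->
    [/\ qpow L (alpha / 2 + 1 / 4) / e1 = r,
        e1 * e2 = p2, e1 * e3 = p3 & e1 * e4 = p4] ->
    [/\ q * A = p2, q * B = e3 * e4, q * B * D = p3, q * C = p4
      & q * C * D = e1 * e1] ->
  qJacobi q L n alpha beta x
  = r ^+ n * qpochs q [:: p2; p3; p4] n / qJacobi_den q L n alpha beta
    * qRacah q n m A B C D.
Proof.
move=> q0 e0 sym -> Rdef [<- <- <- <-] [qA qB qBD qC qCD].
have z0 : e1 * q ^+ m != 0 by rewrite mulf_neq0 ?expf_neq0.
rewrite /qJacobi askey_wilsonE // sym // qpowMn.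
rewrite (@askey_wilson_qRacah _ _ q0 _ _ _ _ _ _ A B C D) // expr_div_n.
ring.
Qed.

Theorem theorem2p4 (R : realType) (n m : nat) (q L alpha beta : R[i])
    (q_neq0 : q != 0) (q_norm : `|q| != 1) (L_log : cexp L = q)
    (den_neq0 : qJacobi_den q L n alpha beta != 0) :
  [/\
    qRacah_defined q n m
      (qpow L alpha) (qpow L beta)
      (- qpow L ((alpha + beta) / 2)) (- qpow L ((alpha - beta - 1) / 2)) ->
    qRacah_defined q m n
      (- qpow L ((alpha + beta) / 2)) (- qpow L ((alpha - beta - 1) / 2))
      (qpow L alpha) (qpow L beta) ->
    [/\ qpow L (alpha + 1 / 2 + m%:R) + q ^- m
        = qRacah_mu q m (- qpow L ((alpha + beta) / 2))
            (- qpow L ((alpha - beta - 1) / 2)),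
        qpow L (alpha + beta + 1 + n%:R) + q ^- n
        = qRacah_mu q n (qpow L alpha) (qpow L beta),
        qJacobi q L n alpha beta
          ((qpow L (alpha / 2 + 1 / 4 + m%:R)
             + qpow L (- (alpha / 2) - 1 / 4 - m%:R)) / 2)
        = qpoch q (qpow L (alpha + 1)) n / qpoch q q n
          * qRacah q n m
              (qpow L alpha) (qpow L beta)
              (- qpow L ((alpha + beta) / 2)) (- qpow L ((alpha - beta - 1) / 2)) &
        qJacobi q L n alpha beta
          ((qpow L (alpha / 2 + 1 / 4 + m%:R)
             + qpow L (- (alpha / 2) - 1 / 4 - m%:R)) / 2)
        = qpoch q (qpow L (alpha + 1)) n / qpoch q q n
          * qRacah q m n
              (- qpow L ((alpha + beta) / 2)) (- qpow L ((alpha - beta - 1) / 2))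
              (qpow L alpha) (qpow L beta)],

    qRacah_defined q n m
      (qpow L alpha) (qpow L beta)
      (- qpow L ((alpha + beta + 1) / 2)) (- qpow L ((alpha - beta) / 2)) ->
    qRacah_defined q m n
      (- qpow L ((alpha + beta + 1) / 2)) (- qpow L ((alpha - beta) / 2))
      (qpow L alpha) (qpow L beta) ->
    [/\ qpow L (alpha + 3 / 2 + m%:R) + q ^- m
        = qRacah_mu q m (- qpow L ((alpha + beta + 1) / 2))
            (- qpow L ((alpha - beta) / 2)),
        qpow L (alpha + beta + 1 + n%:R) + q ^- n
        = qRacah_mu q n (qpow L alpha) (qpow L beta),
        qJacobi q L n alpha beta
          ((qpow L (alpha / 2 + 3 / 4 + m%:R)
             + qpow L (- (alpha / 2) - 3 / 4 - m%:R)) / 2)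
        = qpow L (- n%:R / 2)
          * (qpochs q [:: qpow L (alpha + 1);
                           - qpow L ((alpha + beta + 3) / 2)] n
             / qpochs q [:: q; - qpow L ((alpha + beta + 1) / 2)] n)
          * qRacah q n m
              (qpow L alpha) (qpow L beta)
              (- qpow L ((alpha + beta + 1) / 2)) (- qpow L ((alpha - beta) / 2)) &
        qJacobi q L n alpha beta
          ((qpow L (alpha / 2 + 3 / 4 + m%:R)
             + qpow L (- (alpha / 2) - 3 / 4 - m%:R)) / 2)
        = qpow L (- n%:R / 2)
          * (qpochs q [:: qpow L (alpha + 1);
                           - qpow L ((alpha + beta + 3) / 2)] n
             / qpochs q [:: q; - qpow L ((alpha + beta + 1) / 2)] n)
          * qRacah q m n
              (- qpow L ((alpha + beta + 1) / 2)) (- qpow L ((alpha - beta) / 2))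
              (qpow L alpha) (qpow L beta)],

    qRacah_defined q n m
      (qpow L beta) (qpow L alpha)
      (- qpow L ((alpha + beta) / 2)) (- qpow L ((beta - alpha - 1) / 2)) ->
    qRacah_defined q m n
      (- qpow L ((alpha + beta) / 2)) (- qpow L ((beta - alpha - 1) / 2))
      (qpow L beta) (qpow L alpha) ->
    [/\ qpow L (beta + 1 / 2 + m%:R) + q ^- m
        = qRacah_mu q m (- qpow L ((alpha + beta) / 2))
            (- qpow L ((beta - alpha - 1) / 2)),
        qpow L (alpha + beta + 1 + n%:R) + q ^- n
        = qRacah_mu q n (qpow L beta) (qpow L alpha),
        qJacobi q L n alpha beta
          (- (qpow L (beta / 2 + 1 / 4 + m%:R)
             + qpow L (- (beta / 2) - 1 / 4 - m%:R)) / 2)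
        = (- qpow L ((alpha - beta) / 2)) ^+ n
          * (qpoch q (qpow L (beta + 1)) n / qpoch q q n)
          * qRacah q n m
              (qpow L beta) (qpow L alpha)
              (- qpow L ((alpha + beta) / 2)) (- qpow L ((beta - alpha - 1) / 2)) &
        qJacobi q L n alpha beta
          (- (qpow L (beta / 2 + 1 / 4 + m%:R)
             + qpow L (- (beta / 2) - 1 / 4 - m%:R)) / 2)
        = (- qpow L ((alpha - beta) / 2)) ^+ n
          * (qpoch q (qpow L (beta + 1)) n / qpoch q q n)
          * qRacah q m n
              (- qpow L ((alpha + beta) / 2)) (- qpow L ((beta - alpha - 1) / 2))
              (qpow L beta) (qpow L alpha)] &

    qRacah_defined q n m
      (qpow L beta) (qpow L alpha)
      (- qpow L ((alpha + beta + 1) / 2)) (- qpow L ((beta - alpha) / 2)) ->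
    qRacah_defined q m n
      (- qpow L ((alpha + beta + 1) / 2)) (- qpow L ((beta - alpha) / 2))
      (qpow L beta) (qpow L alpha) ->
    [/\ qpow L (beta + 3 / 2 + m%:R) + q ^- m
        = qRacah_mu q m (- qpow L ((alpha + beta + 1) / 2))
            (- qpow L ((beta - alpha) / 2)),
        qpow L (alpha + beta + 1 + n%:R) + q ^- n
        = qRacah_mu q n (qpow L beta) (qpow L alpha),
        qJacobi q L n alpha beta
          (- (qpow L (beta / 2 + 3 / 4 + m%:R)
             + qpow L (- (beta / 2) - 3 / 4 - m%:R)) / 2)
        = (- qpow L ((alpha - beta - 1) / 2)) ^+ n
          * (qpochs q [:: qpow L (beta + 1);
                           - qpow L ((alpha + beta + 3) / 2)] n
             / qpochs q [:: q; - qpow L ((alpha + beta + 1) / 2)] n)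
          * qRacah q n m
              (qpow L beta) (qpow L alpha)
              (- qpow L ((alpha + beta + 1) / 2)) (- qpow L ((beta - alpha) / 2)) &
        qJacobi q L n alpha beta
          (- (qpow L (beta / 2 + 3 / 4 + m%:R)
             + qpow L (- (beta / 2) - 3 / 4 - m%:R)) / 2)
        = (- qpow L ((alpha - beta - 1) / 2)) ^+ n
          * (qpochs q [:: qpow L (beta + 1);
                           - qpow L ((alpha + beta + 3) / 2)] n
             / qpochs q [:: q; - qpow L ((alpha + beta + 1) / 2)] n)
          * qRacah q m n
              (- qpow L ((alpha + beta + 1) / 2)) (- qpow L ((beta - alpha) / 2))
              (qpow L beta) (qpow L alpha)]].
Proof.
have qq0 k : qpoch q q k != 0 by exact: qpoch_self_neq0.
have powm s : qpow L (s + m%:R) = qpow L s * q ^+ m by rewrite qpowD qpow_nat L_log.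
have pown s : qpow L (s + n%:R) = qpow L s * q ^+ n by rewrite qpowD qpow_nat L_log.
have nodeE s t : qpow L (s + t + m%:R) + qpow L (- s - t - m%:R)
    = qpow L (s + t) * q ^+ m + (qpow L (s + t) * q ^+ m)^-1.
  by rewrite -!opprD qpowN powm.
(* The sign passes into [z], so the negative nodes are based at [- c] and [- d]. *)
have oppNodeE s t : - (qpow L (s + t + m%:R) + qpow L (- s - t - m%:R))
    = - qpow L (s + t) * q ^+ m + (- qpow L (s + t) * q ^+ m)^-1.
  by rewrite nodeE !mulNr invrN opprD.
have half : qpow L (- n%:R / 2) = qpow L (- (1 / 2)) ^+ n.
  by rewrite -qpowMn; congr qpow; field.
rewrite !oppNodeE !nodeE half !powm !pown; move: den_neq0.
set a := qpow L (alpha / 2 + 1 / 4); set b := qpow L (alpha / 2 + 3 / 4).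
set c := qpow L (beta / 2 + 1 / 4); set d := qpow L (beta / 2 + 3 / 4).
have a0 : a != 0 by exact: qpow_neq0.
have b0 : b != 0 by exact: qpow_neq0.
have c0 : - c != 0 by rewrite oppr_eq0 qpow_neq0.
have d0 : - d != 0 by rewrite oppr_eq0 qpow_neq0.
pose AW := askey_wilson_z q n.
(* The second place holds the partner of the base, because [a * b = q^(alpha+1)] and
   [c * d = q^(beta+1)] must equal [q * A]. *)
have sym2 z : z != 0 -> AW a b (- c) (- d) z = AW b a (- c) (- d) z.
  by move=> z0; rewrite /AW askey_wilson_z_swap.
have sym3 z : z != 0 -> AW a b (- c) (- d) z = AW (- c) (- d) a b z.
  move=> z0; rewrite sym2 // /AW askey_wilson_z_perm //.
  by rewrite askey_wilson_z_swap // askey_wilson_z_perm.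
have sym4 z : z != 0 -> AW a b (- c) (- d) z = AW (- d) (- c) a b z.
  move=> z0; rewrite /AW askey_wilson_z_perm askey_wilson_z_perm.
  by rewrite askey_wilson_z_swap // askey_wilson_z_perm askey_wilson_z_perm.
(* All the powers involved are monomials in q^(alpha/4), q^(beta/4), q^(1/4). *)
have qE : q = qpow L (1 / 4) ^+ 4.
  by rewrite -qpowMn -L_log -[L in LHS]mul1r; congr cexp; field.
have mono := (qE,
  qpow_quarters R L alpha beta alpha 4 0 0 0 0 0 ltac:(by field),
  qpow_quarters R L alpha beta beta 0 4 0 0 0 0 ltac:(by field),
  qpow_quarters R L alpha beta (alpha / 2 + 1 / 4) 2 0 1 0 0 0 ltac:(by field),
  qpow_quarters R L alpha beta (alpha / 2 + 3 / 4) 2 0 3 0 0 0 ltac:(by field),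
  qpow_quarters R L alpha beta (beta / 2 + 1 / 4) 0 2 1 0 0 0 ltac:(by field),
  qpow_quarters R L alpha beta (beta / 2 + 3 / 4) 0 2 3 0 0 0 ltac:(by field),
  qpow_quarters R L alpha beta (alpha + 1) 4 0 4 0 0 0 ltac:(by field),
  qpow_quarters R L alpha beta (beta + 1) 0 4 4 0 0 0 ltac:(by field),
  qpow_quarters R L alpha beta ((alpha + beta) / 2) 2 2 0 0 0 0 ltac:(by field),
  qpow_quarters R L alpha beta ((alpha + beta + 1) / 2) 2 2 2 0 0 0 ltac:(by field),
  qpow_quarters R L alpha beta ((alpha + beta + 2) / 2) 2 2 4 0 0 0 ltac:(by field),
  qpow_quarters R L alpha beta ((alpha + beta + 3) / 2) 2 2 6 0 0 0 ltac:(by field),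
  qpow_quarters R L alpha beta ((alpha - beta) / 2) 2 0 0 0 2 0 ltac:(by field),
  qpow_quarters R L alpha beta ((alpha - beta - 1) / 2) 2 0 0 0 2 2 ltac:(by field),
  qpow_quarters R L alpha beta ((beta - alpha) / 2) 0 2 0 2 0 0 ltac:(by field),
  qpow_quarters R L alpha beta ((beta - alpha - 1) / 2) 0 2 0 2 0 2 ltac:(by field),
  qpow_quarters R L alpha beta (alpha + 1 / 2) 4 0 2 0 0 0 ltac:(by field),
  qpow_quarters R L alpha beta (alpha + 3 / 2) 4 0 6 0 0 0 ltac:(by field),
  qpow_quarters R L alpha beta (beta + 1 / 2) 0 4 2 0 0 0 ltac:(by field),
  qpow_quarters R L alpha beta (beta + 3 / 2) 0 4 6 0 0 0 ltac:(by field),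
  qpow_quarters R L alpha beta (alpha + beta + 1) 4 4 4 0 0 0 ltac:(by field),
  qpow_quarters R L alpha beta (- (1 / 2)) 0 0 0 0 0 2 ltac:(by field)).
have den_unfold p2 p3 p4 : qpochs q [:: p2; p3; p4] n
    = qpoch q p2 n * (qpoch q p3 n * qpoch q p4 n).
  by rewrite /qpochs !big_cons big_nil mulr1.
rewrite /qJacobi_den den_unfold !mulf_eq0 !negb_or => /and3P[_ den1 den2].
have qpochs2 p2 p3 : qpochs q [:: p2; p3] n = qpoch q p2 n * qpoch q p3 n.
  by rewrite /qpochs !big_cons big_nil mulr1.
(* The second value follows from the first by duality, so each node is evaluated once. *)
have dup (P P' : Prop) (x y y' : R[i]) :
    P -> P' -> x = y -> y = y' -> [/\ P, P', x = y & x = y'] by move=> ? ? -> ->.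
split.
{ move=> Rdef _; apply: dup; [| | |by congr (_ * _); exact: qRacah_dual].
  1, 2: rewrite addrC /qRacah_mu; congr (_ + _); rewrite exprS.
  (* The power [q^m] is generalized first, since [mono] would also rewrite the [q] inside it. *)
  1: by move: (q ^+ m) => w; rewrite !mono; field; rewrite ?qpow_neq0.
  1: by move: (q ^+ n) => w; rewrite !mono; field; rewrite ?qpow_neq0.
  (* The base is [a] itself, so [r = 1]; [p3] and [p4] both cancel against [qJacobi_den]. *)
  rewrite (@qJacobi_node _ n m q L alpha beta _ a b (- c) (- d)
    1
    (qpow L (alpha + 1)) (- qpow L ((alpha + beta + 1) / 2))
    (- qpow L ((alpha + beta + 2) / 2))
    _ _ _ _ q_neq0 a0 (fun _ _ => erefl) erefl Rdef);
    [ | by split; rewrite ?/a ?/b ?/c ?/d !mono; field; rewrite ?oppr_eq0 ?qpow_neq0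
      | by split; rewrite ?/a ?/b ?/c ?/d !mono; field; rewrite ?oppr_eq0 ?qpow_neq0 ].
  congr (_ * _); rewrite /qJacobi_den !den_unfold ?qpochs2 ?expr1n.
  by field; rewrite qq0 den1 den2. }
{ move=> Rdef _; apply: dup; [| | |by congr (_ * _); exact: qRacah_dual].
  1, 2: rewrite addrC /qRacah_mu; congr (_ + _); rewrite exprS.
  1: by move: (q ^+ m) => w; rewrite !mono; field; rewrite ?qpow_neq0.
  1: by move: (q ^+ n) => w; rewrite !mono; field; rewrite ?qpow_neq0.
  (* Here [r = a/b = q^(-1/2)], and only [p3] cancels: [p4] survives as the extra factor over
     [- q^((alpha+beta+1)/2)]. *)
  rewrite (@qJacobi_node _ n m q L alpha beta _ b a (- c) (- d)
    (qpow L (- (1 / 2)))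
    (qpow L (alpha + 1)) (- qpow L ((alpha + beta + 2) / 2))
    (- qpow L ((alpha + beta + 3) / 2))
    _ _ _ _ q_neq0 b0 sym2 erefl Rdef);
    [ | by split; rewrite ?/a ?/b ?/c ?/d !mono; field; rewrite ?oppr_eq0 ?qpow_neq0
      | by split; rewrite ?/a ?/b ?/c ?/d !mono; field; rewrite ?oppr_eq0 ?qpow_neq0 ].
  congr (_ * _); rewrite /qJacobi_den !den_unfold ?qpochs2 ?expr1n.
  by field; rewrite qq0 den1 den2. }
{ move=> Rdef _; apply: dup; [| | |by congr (_ * _); exact: qRacah_dual].
  1, 2: rewrite addrC /qRacah_mu; congr (_ + _); rewrite exprS.
  1: by move: (q ^+ m) => w; rewrite !mono; field; rewrite ?qpow_neq0.
  1: by move: (q ^+ n) => w; rewrite !mono; field; rewrite ?qpow_neq0.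
  (* Now [r = - a/c], and the cancellation is that of the base [a]. *)
  rewrite (@qJacobi_node _ n m q L alpha beta _ (- c) (- d) a b
    (- qpow L ((alpha - beta) / 2))
    (qpow L (beta + 1)) (- qpow L ((alpha + beta + 1) / 2))
    (- qpow L ((alpha + beta + 2) / 2))
    _ _ _ _ q_neq0 c0 sym3 erefl Rdef);
    [ | by split; rewrite ?/a ?/b ?/c ?/d !mono; field; rewrite ?oppr_eq0 ?qpow_neq0
      | by split; rewrite ?/a ?/b ?/c ?/d !mono; field; rewrite ?oppr_eq0 ?qpow_neq0 ].
  congr (_ * _); rewrite /qJacobi_den !den_unfold ?qpochs2 ?expr1n.
  by field; rewrite qq0 den1 den2. }
{ move=> Rdef _; apply: dup; [| | |by congr (_ * _); exact: qRacah_dual].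
  1, 2: rewrite addrC /qRacah_mu; congr (_ + _); rewrite exprS.
  1: by move: (q ^+ m) => w; rewrite !mono; field; rewrite ?qpow_neq0.
  1: by move: (q ^+ n) => w; rewrite !mono; field; rewrite ?qpow_neq0.
  (* Now [r = - a/d], and the cancellation is that of the base [b]. *)
  rewrite (@qJacobi_node _ n m q L alpha beta _ (- d) (- c) a b
    (- qpow L ((alpha - beta - 1) / 2))
    (qpow L (beta + 1)) (- qpow L ((alpha + beta + 2) / 2))
    (- qpow L ((alpha + beta + 3) / 2))
    _ _ _ _ q_neq0 d0 sym4 erefl Rdef);
    [ | by split; rewrite ?/a ?/b ?/c ?/d !mono; field; rewrite ?oppr_eq0 ?qpow_neq0
      | by split; rewrite ?/a ?/b ?/c ?/d !mono; field; rewrite ?oppr_eq0 ?qpow_neq0 ].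
  congr (_ * _); rewrite /qJacobi_den !den_unfold ?qpochs2 ?expr1n.
  by field; rewrite qq0 den1 den2. }
Qed.
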